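(* Let $d\in\mathbb{N}$ and let $p_d:\mathbb{R}\to\mathbb{C}$ be a polynomial of degree $d$. Then (1) the function $f:\widetilde{\mathbf{SL}}_2(\mathbb{R})\to\mathbb{C}$ given by $f(x,y,t)=p_d(t)\cdot y$ is proper $r$-harmonic on $\widetilde{\mathbf{SL}}_2(\mathbb{R})$, where $r=\lfloor d/2\rfloor+1$; (2) the function $g:\widetilde{\mathbf{SL}}_2(\mathbb{R})\to\mathbb{C}$ given by $g(x,y,t)=p_d(t)\cdot x$ is proper $r$-harmonic on $\widetilde{\mathbf{SL}}_2(\mathbb{R})$, where $r=\lceil d/2\rceil+1$.
   Context: $\mathbb{N}$ denotes the natural numbers including $0$. $\widetilde{\mathbf{SL}}_2(\mathbb{R})$ denotes the Riemannian manifold $\{(x,y,t)\in\mathbb{R}^3 : y>0\}$ with metric $ds^2=\frac{1}{y^2}(dx^2+dy^2)+\left(dt+\frac{dx}{y}\right)^2$. Its Laplace-Beltrami operator, acting on smooth complex-valued functions, is $$\tau(f)=y^2\left(\frac{\partial^2 f}{\partial x^2}+\frac{\partial^2 f}{\partial y^2}\right)+2\frac{\partial^2 f}{\partial t^2}-2y\frac{\partial^2 f}{\partial x\partial t}.$$ Put $\tau^0(f)=f$ and $\tau^r(f)=\tau(\tau^{r-1}(f))$. For $r\ge1$, a smooth function $f$ is $r$-harmonic if $\tau^r(f)=0$ identically, and proper $r$-harmonic if $\tau^r(f)=0$ and $\tau^{r-1}(f)$ does not vanish identically. *)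

(* Defs.v *)
From mathcomp Require Import all_boot all_order all_algebra.
From mathcomp Require Import all_classical all_reals all_analysis.
From mathcomp Require Import complex.

Set Implicit Arguments.
Unset Strict Implicit.
Unset Printing Implicit Defensive.

Import Order.TTheory GRing.Theory Num.Theory.
Import numFieldNormedType.Exports.

Local Open Scope ring_scope.
Local Open Scope complex_scope.

(* The manifold SL2~(R) is the half-space {(x,y,t) : y > 0}.  A function on it
   is represented by a total function f x y t, of which only the values at
   points with y > 0 matter: every predicate below is restricted to that open
   set, on which the partial derivatives of f depend only on the values of f
   there. *)
Definition cfun3 (R : realType) := R -> R -> R -> R[i].

(* R[i] is not a normed module over R in the library, so complex-valued
   functions of a real variable are differentiated componentwise. *)
Definition cderivable (R : realType) (u : R -> R[i]) (s : R) : Prop :=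
  derivable (fun z => complex.Re (u z)) s 1 /\
  derivable (fun z => complex.Im (u z)) s 1.

Definition cderive (R : realType) (u : R -> R[i]) (s : R) : R[i] :=
  (fun z => complex.Re (u z))^`()%classic s +i*
  (fun z => complex.Im (u z))^`()%classic s.

Definition partial_x (R : realType) (f : cfun3 R) : cfun3 R :=
  fun x y t => cderive (fun s => f s y t) x.
Definition partial_y (R : realType) (f : cfun3 R) : cfun3 R :=
  fun x y t => cderive (fun s => f x s t) y.
Definition partial_t (R : realType) (f : cfun3 R) : cfun3 R :=
  fun x y t => cderive (fun s => f x y s) t.

Definition ccontinuous_at (R : realType) (f : cfun3 R) (x y t : R) : Prop :=
  {for (x, y, t), continuous
     (fun q : R * R * R => complex.Re (f q.1.1 q.1.2 q.2))} /\
  {for (x, y, t), continuous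
     (fun q : R * R * R => complex.Im (f q.1.1 q.1.2 q.2))}.

Definition partials_exist_at (R : realType) (f : cfun3 R) (x y t : R) : Prop :=
  [/\ cderivable (fun s => f s y t) x,
      cderivable (fun s => f x s t) y &
      cderivable (fun s => f x y s) t].

(* f is of class C^k on {y > 0} *)
Fixpoint class_C (R : realType) (k : nat) (f : cfun3 R) : Prop :=
  (forall x y t : R, 0 < y -> ccontinuous_at f x y t) /\
  (if k is k'.+1 then
     (forall x y t : R, 0 < y -> partials_exist_at f x y t) /\
     [/\ class_C k' (partial_x f), class_C k' (partial_y f) &
         class_C k' (partial_t f)]
   else True).

Definition smooth (R : realType) (f : cfun3 R) : Prop :=
  forall k : nat, class_C k f.

(* The Laplace-Beltrami operator of the metric
   ds^2 = (dx^2 + dy^2) / y^2 + (dt + dx / y)^2. *)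
Definition tau (R : realType) (f : cfun3 R) : cfun3 R :=
  fun x y t =>
    (y ^+ 2)%:C * (partial_x (partial_x f) x y t + partial_y (partial_y f) x y t)
    + 2 * partial_t (partial_t f) x y t
    - 2 * y%:C * partial_x (partial_t f) x y t.

Definition vanishes (R : realType) (f : cfun3 R) : Prop :=
  forall x y t : R, 0 < y -> f x y t = 0.

Definition harmonic (R : realType) (r : nat) (f : cfun3 R) : Prop :=
  [/\ (0 < r)%N, smooth f & vanishes (iter r (@tau R) f)].

Definition proper_harmonic (R : realType) (r : nat) (f : cfun3 R) : Prop :=
  harmonic r f /\ ~ vanishes (iter r.-1 (@tau R) f).

(* Main.v *)
(* On functions a(t) x + b(t) y the operator acts by
   (a, b) |-> (2 a'', 2 b'' - 2 a'), so tau^n sends (a, b) to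
   2^n (a^(2n), b^(2n) - n a^(2n-1)), and such a function vanishes only if both
   coefficients do.  For p(t) x, the pair coming from (p, 0), the last nonzero
   iterate survives in the x-coefficient when d is even and in the
   y-coefficient when d is odd. *)
Require Import Defs.
From mathcomp Require Import all_boot all_order all_algebra.
From mathcomp Require Import all_classical all_reals all_analysis.
From mathcomp Require Import complex ring.

Import Order.TTheory GRing.Theory Num.Theory.
Import numFieldNormedType.Exports.

Local Open Scope ring_scope.
Local Open Scope complex_scope.

(* Unlike [hornerE], leaves sums in a form that [ring] recognizes. *)
Definition horner_ringE (R : comNzRingType) :=
  (@hornerD R, @hornerN R, @hornerZ R, @hornerMn R, @hornerX R, @hornerC R,
   @horner0 R).

(** Derivatives and continuity are defined componentwise, so this splitting carries questions about
    complex polynomials at real arguments over to real polynomials. *)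
Lemma poly_Re_Im (R : realType) (p : {poly R[i]}) :
  exists a b : {poly R}, p =
    map_poly (real_complex R) a + 'i%C *: map_poly (real_complex R) b.
Proof.
exists (map_poly (@complex.Re R) p), (map_poly (@complex.Im R) p).
by apply/polyP => i; rewrite coefD coefZ !coef_map_id0//; exact: complexE.
Qed.

Lemma horner_Re_Im (R : realType) (a b : {poly R}) (s : R) :
  (map_poly (real_complex R) a + 'i%C *: map_poly (real_complex R) b).[s%:C] =
  a.[s] +i* b.[s].
Proof. by rewrite hornerD hornerZ !horner_map [RHS]complexE. Qed.

Lemma cderivable_horner (R : realType) (p : {poly R[i]}) (s : R) :
  cderivable (fun z => p.[z%:C]) s.
Proof.
have [a [b ->]] := poly_Re_Im R p; split;
  under [X in derivable X]funext do rewrite horner_Re_Im;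
  exact: derivable_horner.
Qed.

Lemma cderive_horner (R : realType) (p : {poly R[i]}) (s : R) :
  cderive (fun z => p.[z%:C]) s = p^`().[s%:C].
Proof.
have [a [b ->]] := poly_Re_Im R p; rewrite derivD derivZ !deriv_map horner_Re_Im.
rewrite /cderive; congr (_ +i* _);
  under [X in X^`()%classic]funext do rewrite horner_Re_Im /=;
  by rewrite derive1E derive_val.
Qed.

(* The term [c] makes the family stable under all partial derivatives. *)
Definition affine_xy (R : realType) (a b c : {poly R[i]}) : cfun3 R :=
  fun x y t => a.[t%:C] * x%:C + b.[t%:C] * y%:C + c.[t%:C].
Arguments affine_xy {R}.

Section AffineXY.
Variable R : realType.
Implicit Types a b c : {poly R[i]}.

(** Freezing two variables leaves a complex polynomial in the third, to which [cderive_horner] and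
    [cderivable_horner] apply. The next two lemmas do the same for the other variables. *)
Lemma affine_xyEx a b c (y t : R) : (fun s => affine_xy a b c s y t) =
  (fun s => (a.[t%:C] *: 'X + (b.[t%:C] * y%:C + c.[t%:C])%:P).[s%:C]).
Proof. by apply/funext => s; rewrite /affine_xy !horner_ringE; ring. Qed.

Lemma affine_xyEy a b c (x t : R) : (fun s => affine_xy a b c x s t) =
  (fun s => (b.[t%:C] *: 'X + (a.[t%:C] * x%:C + c.[t%:C])%:P).[s%:C]).
Proof. by apply/funext => s; rewrite /affine_xy !horner_ringE; ring. Qed.

Lemma affine_xyEt a b c (x y : R) : (fun s => affine_xy a b c x y s) =
  (fun s => (x%:C *: a + y%:C *: b + c).[s%:C]).
Proof. by apply/funext => s; rewrite /affine_xy !horner_ringE; ring. Qed.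

Lemma partial_x_affine_xy a b c :
  partial_x (affine_xy a b c) = affine_xy 0 0 a.
Proof.
apply/funext => x; apply/funext => y; apply/funext => t.
by rewrite /partial_x affine_xyEx cderive_horner
     !(derivD, derivZ, derivX, derivC)
     /affine_xy !horner_ringE; ring.
Qed.

Lemma partial_y_affine_xy a b c :
  partial_y (affine_xy a b c) = affine_xy 0 0 b.
Proof.
apply/funext => x; apply/funext => y; apply/funext => t.
by rewrite /partial_y affine_xyEy cderive_horner
     !(derivD, derivZ, derivX, derivC)
     /affine_xy !horner_ringE; ring.
Qed.

Lemma partial_t_affine_xy a b c :
  partial_t (affine_xy a b c) = affine_xy a^`() b^`() c^`().
Proof.
apply/funext => x; apply/funext => y; apply/funext => t.
by rewrite /partial_t affine_xyEt cderive_horner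
     !(derivD, derivZ, derivX, derivC)
     /affine_xy !horner_ringE; ring.
Qed.

Lemma ccontinuous_affine_xy a b c (x y t : R) :
  ccontinuous_at (affine_xy a b c) x y t.
Proof.
have [a1 [a2 ->]] := poly_Re_Im R a; have [b1 [b2 ->]] := poly_Re_Im R b.
have [c1 [c2 ->]] := poly_Re_Im R c.
(* As x and y are real, the real and imaginary parts both have this same shape, with real
   coefficients. *)
have aux (p q r : {poly R}) (f : R * R * R -> R) :
    (forall z, f z = p.[z.2] * z.1.1 + q.[z.2] * z.1.2 + r.[z.2]) ->
    {for (x, y, t), continuous f}.
  move=> /funext ->.
  have ct (p' : {poly R}) :
      {for (x, y, t), continuous (fun z : R * R * R => p'.[z.2])}.
    apply: (@continuous_comp _ _ _ snd (horner p')); first exact: cvg_snd.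
    exact: continuous_horner.
  have cx : {for (x, y, t), continuous (fun z : R * R * R => z.1.1)}.
    by apply: (@continuous_comp _ _ _ fst fst); exact: cvg_fst.
  have cy : {for (x, y, t), continuous (fun z : R * R * R => z.1.2)}.
    by apply: (@continuous_comp _ _ _ fst snd); [exact: cvg_fst|exact: cvg_snd].
  by apply: cvgD; [apply: cvgD; apply: cvgM|]; try exact: ct.
split.
- by apply: (aux a1 b1 c1) => z; rewrite /affine_xy !horner_Re_Im /= !mulr0 !subr0.
- by apply: (aux a2 b2 c2) => z; rewrite /affine_xy !horner_Re_Im /= !mulr0 !add0r.
Qed.

Lemma smooth_affine_xy a b c : smooth (affine_xy a b c).
Proof.
(* The induction generalizes over the coefficients, since each partial derivative stays in the
   family but changes them. *)
move=> k; elim: k => [|k IHk] in a b c *; split=> //;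
  try by move=> *; exact: ccontinuous_affine_xy.
split; last by rewrite partial_x_affine_xy partial_y_affine_xy partial_t_affine_xy.
move=> x y t _; split.
- by rewrite affine_xyEx; exact: cderivable_horner.
- by rewrite affine_xyEy; exact: cderivable_horner.
- by rewrite affine_xyEt; exact: cderivable_horner.
Qed.

(** The pure second derivatives in x and y vanish. The mixed derivative is a'(t), and its factor -2y
    moves it into the coefficient of y. *)
Lemma tau_affine_xy a b :
  tau (affine_xy a b 0) = affine_xy (a^`(2) *+ 2) ((b^`(2) - a^`()) *+ 2) 0.
Proof.
apply/funext => x; apply/funext => y; apply/funext => t.
rewrite /tau !(partial_x_affine_xy, partial_y_affine_xy, partial_t_affine_xy).
by rewrite !(derivD, derivZ, derivX, derivC)
     /affine_xy /= !horner_ringE; ring.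
Qed.

Lemma iter_tau_affine_xy n a b :
  iter n (@tau R) (affine_xy a b 0) =
  affine_xy (a^`(n.*2) *+ 2 ^ n)
            ((b^`(n.*2) - a^`(n.*2.-1) *+ n) *+ 2 ^ n) 0.
Proof.
elim: n => [|n IHn]; first by rewrite /= mulr0n subr0 !mulr1n.
rewrite iterS IHn tau_affine_xy expnSr !mulrnA; congr (affine_xy (_ *+ 2) (_ *+ 2) 0).
  by rewrite derivnMn.
rewrite derivnMn derivMn -mulrnBl derivnB derivnMn; congr (_ *+ _).
rewrite mulrSr opprD addrA; congr (_ - _ - _).
(* Differentiating twice turns the order [n.*2.-1] into [n.*2.+1] only for positive [n]; at 0 the
   predecessor is truncated, but both sides are zero multiples. *)
by case: n {IHn}.
Qed.

Lemma vanishes_affine_xy a b :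
  vanishes (affine_xy a b 0) <-> a = 0 /\ b = 0.
Proof.
split=> [ab0|[-> ->] x y t _]; last by rewrite /affine_xy !horner_ringE; ring.
have poly0 (p : {poly R[i]}) : (forall t : R, p.[t%:C] = 0) -> p = 0.
  move=> p0; apply: contraTeq isT => p_neq0.
  (* The numbers 0, ..., [size p] - 1 would be [size p] distinct roots, one more than the degree
     allows. *)
  have := @max_poly_roots _ p [seq i%:R | i <- iota 0 (size p)] p_neq0.
  rewrite size_map size_iota ltnn; apply.
    apply/allP => _ /mapP[i _ ->]; rewrite /root -(rmorph_nat (real_complex R)).
    by apply/eqP/p0.
  by rewrite map_inj_uniq ?iota_uniq// => i j /eqP; rewrite eqr_nat => /eqP.
have b0 : b = 0.
  (* The point x = 0, y = 1 isolates b; once b is zero, x = y = 1 isolates a. *)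
  apply: poly0 => t; have := ab0 0 1 t ltr01.
  by rewrite /affine_xy !hornerE.
split=> //; apply: poly0 => t; have := ab0 1 1 t ltr01.
by rewrite /affine_xy b0 !hornerE.
Qed.

End AffineXY.

Theorem lemma5p2 (R : realType) (d : nat) (p : {poly R[i]})
    (deg_p : size p = d.+1) :
  proper_harmonic d./2.+1 (fun x y t : R => p.[t%:C] * y%:C) /\
  proper_harmonic (uphalf d).+1 (fun x y t : R => p.[t%:C] * x%:C).
Proof.
have derivn_eq0 n : (d < n)%N -> p^`(n) = 0.
  by move=> lt_d_n; rewrite derivn_poly0// deg_p.
have derivn_neq0 n : (n <= d)%N -> p^`(n) != 0.
  (* The coefficient of index [d - n] in the n-th derivative is the leading coefficient of p times a
     nonzero falling factorial. *)
  move=> le_n_d; apply/eqP => /(congr1 (fun q : {poly R[i]} => q`_(d - n))).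
  rewrite coef_derivn subnKC// coef0 => /eqP; rewrite mulrn_eq0.
  rewrite -[d]/d.+1.-1 -deg_p -lead_coefE lead_coef_eq0 -size_poly_eq0 deg_p /=.
  by rewrite orbF -leqn0 leqNgt ffact_gt0 le_n_d.
have mulrn2X_eq0 n (q : {poly R[i]}) : q *+ 2 ^ n = 0 -> q = 0.
  move=> /eqP; rewrite -scaler_nat scaler_eq0 pnatr_eq0 expn_eq0/=.
  by move/eqP.
have -> : (fun x y t : R => p.[t%:C] * y%:C) = affine_xy 0 p 0.
  apply/funext => x; apply/funext => y; apply/funext => t.
  by rewrite /affine_xy !horner_ringE; ring.
have -> : (fun x y t : R => p.[t%:C] * x%:C) = affine_xy p 0 0.
  apply/funext => x; apply/funext => y; apply/funext => t.
  by rewrite /affine_xy !horner_ringE; ring.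
split; (split; [split=> //; first exact: smooth_affine_xy|]);
  rewrite iter_tau_affine_xy vanishes_affine_xy !linear0.
- rewrite !mul0rn subr0 derivn_eq0 ?mul0rn//.
  by rewrite -ltn_half_double.
- case=> _ /mulrn2X_eq0; rewrite mul0rn subr0; apply/eqP/derivn_neq0.
  by rewrite /= -geq_half_double.
(* Both orders that occur, 2r and 2r - 1 with r = [(uphalf d).+1], exceed d. *)
- rewrite sub0r !derivn_eq0 ?mul0rn ?oppr0 ?mul0rn//.
    by rewrite doubleS /= ltnS -leq_uphalf_double.
  by rewrite doubleS ltnS leqW// -leq_uphalf_double.
- rewrite [_.-1]/= uphalf_half; have := odd_double_half d.
  (* With n = [uphalf d]: for odd d, 2n - 1 = d and the y-coefficient is a nonzero multiple of the
     d-th derivative of p; for even d, 2n = d and [a_eq0] already contradicts [derivn_neq0]. *)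
  case: (odd d) => dE [/mulrn2X_eq0 a_eq0 /mulrn2X_eq0/eqP].
    rewrite sub0r oppr_eq0 -scaler_nat scaler_eq0 pnatr_eq0 add1n orFb.
    by apply/negP/derivn_neq0; rewrite doubleS -[in leqRHS]dE.
  by move/eqP: a_eq0 => + _; apply/negP/derivn_neq0; rewrite -[in leqRHS]dE.
Qed.
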